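(* Let $Q$ be a divisible unital quantale with associated quantaloid $\mathcal{Q}$. There is a functor $\mathcal{K}:(\mathcal{Q}\text{-}\mathbf{Ctx})^{\mathrm{op}}\to\mathcal{Q}\text{-}\mathbf{CCat}$ that sends each fuzzy context $(\mathsf{A},\mathsf{B},\phi)$ to its property oriented concept lattice $\mathcal{K}_{\phi}(\mathsf{A},\mathsf{B})$. This functor is obtained by restricting to $(\mathcal{Q}\text{-}\mathbf{Ctx})^{\mathrm{op}}$ the domain of the functor $\mathcal{K}:(\mathcal{Q}\text{-}\mathbf{Info})^{\mathrm{op}}\to\mathcal{Q}\text{-}\mathbf{CCat}$, which sends $\phi:\mathbb{A}\rightsquigarrow\mathbb{B}$ to $\mathcal{K}(\phi)=\phi_*\circ\phi^*(\mathcal{P}\mathbb{B})$ and an infomorphism $(F,G):\phi\to\psi$ to $\phi_*\circ\phi^*\circ G^{\rightarrow}:\mathcal{K}(\psi)\to\mathcal{K}(\phi)$, and identifying $\mathcal{K}_{\phi}(\mathsf{A},\mathsf{B})$ with $\mathcal{K}(\phi)$ via $(\mu,\lambda)\mapsto\lambda$.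
   Context: A unital quantale is a complete lattice $Q$ with a monoid operation $\&$ (unit $I$) preserving arbitrary joins in each variable; $a\backslash b$ and $b/a$ are determined by $c\le a\backslash b\iff a\& c\le b$ and $c\le b/a\iff c\& a\le b$. It is divisible if $a\le b$ implies $x\& b=a=b\& y$ for some $x,y\in Q$; then $I$ is the top element. A divisible unital quantale $Q$ induces a small quantaloid $\mathcal{Q}$ (a category whose hom-sets are complete lattices with composition preserving joins in each variable): objects are the elements of $Q$; $\mathcal{Q}(X,Y)=\{\alpha\in Q:\alpha\le X\wedge Y\}$ with order from $Q$; composition of $\alpha\in\mathcal{Q}(X,Y)$ and $\beta\in\mathcal{Q}(Y,Z)$ is $\beta\circ\alpha=\beta\&(Y\backslash\alpha)=(\beta/Y)\&\alpha$; the identity on $X$ is $X$. In a quantaloid, for $f:X\to Y$, $h:X\to Z$, $h\swarrow f:Y\to Z$ is the largest arrow with $(h\swarrow f)\circ f\le h$. A $\mathcal{Q}$-category $\mathbb{A}$ is a set $\mathbb{A}_0$ with a type map $t$ to the objects of $\mathcal{Q}$ and hom-arrows $\mathbb{A}(x,y)\in\mathcal{Q}(tx,ty)$ with $1_{tx}\le\mathbb{A}(x,x)$ and $\mathbb{A}(y,z)\circ\mathbb{A}(x,y)\le\mathbb{A}(x,z)$. A $\mathcal{Q}$-functor is a type-preserving map with $\mathbb{A}(x,x')\le\mathbb{B}(Fx,Fx')$. The underlying preorder is $x\le y$ iff $tx=ty$ and $1_{tx}\le\mathbb{A}(x,y)$; $\mathbb{A}$ is skeletal if it is antisymmetric; $\mathcal{Q}$-functors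 are ordered pointwise, and $F$ is left adjoint to $G$ if $1\le G\circ F$, $F\circ G\le 1$. A $\mathcal{Q}$-distributor $\phi:\mathbb{A}\rightsquigarrow\mathbb{B}$ assigns to $(x,y)\in\mathbb{A}_0\times\mathbb{B}_0$ an arrow $\phi(x,y)\in\mathcal{Q}(tx,ty)$ with $\mathbb{B}(y',y)\circ\phi(x,y')\le\phi(x,y)$ and $\phi(x',y)\circ\mathbb{A}(x,x')\le\phi(x,y)$; distributors form a quantaloid with pointwise order, composition $(\psi\circ\phi)(x,z)=\bigvee_y\psi(y,z)\circ\phi(x,y)$, and $(\eta\swarrow\phi)(y,z)=\bigwedge_x\eta(x,z)\swarrow\phi(x,y)$. $*_X$ is the $\mathcal{Q}$-category with one object of type $X$ and hom-arrow $1_X$. $\mathcal{P}\mathbb{A}$ has as objects of type $X$ the distributors $\mu:\mathbb{A}\rightsquigarrow *_X$, with $\mathcal{P}\mathbb{A}(\mu,\lambda)=\lambda\swarrow\mu$. For $\phi:\mathbb{A}\rightsquigarrow\mathbb{B}$: $\phi^*:\mathcal{P}\mathbb{B}\to\mathcal{P}\mathbb{A}$, $\phi^*(\lambda)=\lambda\circ\phi$, and $\phi_*:\mathcal{P}\mathbb{A}\to\mathcal{P}\mathbb{B}$, $\phi_*(\mu)=\mu\swarrow\phi$; $\phi_*\circ\phi^*(\mathcal{P}\mathbb{B})$ is the full $\mathcal{Q}$-subcategory of fixed points of $\phi_*\circ\phi^*$. For $G:\mathbb{B}'\to\mathbb{B}$, $G^{\rightarrow}:\mathcal{P}\mathbb{B}'\to\mathcal{P}\mathbb{B}$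 is $G^{\rightarrow}(\mu)=\mu\circ G^{\natural}$ with $G^{\natural}(y,y')=\mathbb{B}(y,Gy')$. $\mathbb{A}$ is complete if for every $\mu\in\mathcal{P}\mathbb{A}$ there is $a\in\mathbb{A}_0$ with $\mathbb{A}(a,-)=\mathbb{A}\swarrow\mu$ (equivalently, it has all weighted limits). $\mathcal{Q}\text{-}\mathbf{CCat}$ is the category of skeletal complete $\mathcal{Q}$-categories (separated complete $Q$-preordered $Q$-subsets) and left adjoint $\mathcal{Q}$-functors. $\mathcal{Q}\text{-}\mathbf{Info}$ has $\mathcal{Q}$-distributors as objects; a morphism (infomorphism) $(F,G)$ from $\phi:\mathbb{A}\rightsquigarrow\mathbb{B}$ to $\psi:\mathbb{A}'\rightsquigarrow\mathbb{B}'$ is a pair of $\mathcal{Q}$-functors $F:\mathbb{A}\to\mathbb{A}'$, $G:\mathbb{B}'\to\mathbb{B}$ with $\phi(x,Gy')=\psi(Fx,y')$ for all $x,y'$. A $Q$-subset $\mathsf{A}$ is a set $\mathsf{A}_0$ with a map $\mathsf{A}:\mathsf{A}_0\to Q$; it is regarded as a discrete $\mathcal{Q}$-category with $tx=\mathsf{A}x$, $\mathsf{A}(x,x)=\mathsf{A}x$ and $\mathsf{A}(x,y)=0$ for $x\ne y$. A fuzzy context is a triple $(\mathsf{A},\mathsf{B},\phi)$ of $Q$-subsets $\mathsf{A},\mathsf{B}$ and a distributor $\phi:\mathsf{A}\rightsquigarrow\mathsf{B}$ (i.e. a map $\phi:\mathsf{A}_0\times\mathsf{B}_0\to Q$ with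 $\phi(x,y)\le\mathsf{A}x\wedge\mathsf{B}y$). $\mathcal{Q}\text{-}\mathbf{Ctx}$ is the full subcategory of $\mathcal{Q}\text{-}\mathbf{Info}$ on fuzzy contexts. The property oriented concept lattice $\mathcal{K}_{\phi}(\mathsf{A},\mathsf{B})$ has as objects the pairs $(\mu,\lambda)\in(\mathcal{P}\mathsf{A})_0\times(\mathcal{P}\mathsf{B})_0$ with $\lambda=\phi_*(\mu)$ and $\mu=\phi^*(\lambda)$, of type $t\mu=t\lambda$, with hom from $(\mu,\lambda)$ to $(\mu',\lambda')$ equal to $\mathcal{P}\mathsf{A}(\mu,\mu')=\mathcal{P}\mathsf{B}(\lambda,\lambda')$. *)

(* Defs.v *)
From HB Require Import structures.
From mathcomp Require Import all_boot all_order.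
From mathcomp Require Import boolp classical_sets.

Set Implicit Arguments.
Unset Strict Implicit.
Unset Printing Implicit Defensive.

Import Order.TTheory.
Local Open Scope classical_set_scope.
Local Open Scope group_scope.
Local Open Scope order_scope.

Declare Scope quantaloid_scope.
Delimit Scope quantaloid_scope with qtd.
Local Open Scope quantaloid_scope.

HB.mixin Record TBLattice_isComplete d T of Order.TBLattice d T := {
  cjoin : set T -> T;
  cjoin_supremum : forall S : set T, supremums S (cjoin S)
}.

#[short(type="completeLatticeType")]
HB.structure Definition CompleteLattice d :=
  { T of Order.TBLattice d T & TBLattice_isComplete d T }.

Definition cmeet d (L : completeLatticeType d) (S : set L) : L :=
  cjoin (lbound S).

HB.mixin Record isQuantale d T of CompleteLattice d T & Monoid T := {
  mul_cjoinl : forall (S : set T) (b : T),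
    (cjoin S * b)%g = cjoin [set (a * b)%g | a in S];
  mul_cjoinr : forall (a : T) (S : set T),
    (a * cjoin S)%g = cjoin [set (a * b)%g | b in S]
}.

#[short(type="quantaleType")]
HB.structure Definition Quantale d :=
  { T of CompleteLattice d T & Monoid T & isQuantale d T }.

HB.mixin Record Quantale_isDivisible d T of Quantale d T := {
  divisible : forall a b : T, a <= b ->
    (exists x : T, (x * b)%g = a) /\ (exists y : T, (b * y)%g = a)
}.

#[short(type="divQuantaleType")]
HB.structure Definition DivQuantale d :=
  { T of Quantale d T & Quantale_isDivisible d T }.

Section CompleteLatticeTheory.
Context {d : Order.disp_t} {L : completeLatticeType d}.
Implicit Types (S : set L) (x z : L).

Lemma cjoin_ub S x : S x -> x <= cjoin S.
Proof. by case: (cjoin_supremum S) => + _; apply. Qed.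

Lemma cjoin_least S z : (forall x, S x -> x <= z) -> cjoin S <= z.
Proof. by move=> h; case: (cjoin_supremum S) => _; apply. Qed.

Lemma cmeet_lb S x : S x -> cmeet S <= x.
Proof. by move=> Sx; apply: cjoin_least => z; apply. Qed.

Lemma cmeet_greatest S z : (forall x, S x -> z <= x) -> z <= cmeet S.
Proof. by move=> h; apply: cjoin_ub. Qed.

End CompleteLatticeTheory.

(* [ldiv a b] is a \ b and [rdiv b a] is b / a; see le_ldiv and le_rdiv. *)
Definition ldiv d (Q : quantaleType d) (a b : Q) : Q :=
  cjoin [set c : Q | (a * c)%g <= b].
Definition rdiv d (Q : quantaleType d) (b a : Q) : Q :=
  cjoin [set c : Q | (c * a)%g <= b].

Section QuantaleTheory.
Context {d : Order.disp_t} {Q : quantaleType d}.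
Implicit Types a b c x y : Q.

Lemma cjoin_pair b c : b <= c -> cjoin [set b; c] = c.
Proof.
move=> bc; apply/le_anti/andP; split; last by apply: cjoin_ub; right.
by apply: cjoin_least => z [->|->].
Qed.

Lemma qmul_le2l a b c : b <= c -> (a * b <= a * c)%g.
Proof.
move=> bc; rewrite -(cjoin_pair bc) mul_cjoinr.
by apply: cjoin_ub; exists b => //; left.
Qed.

Lemma qmul_le2r a b c : b <= c -> (b * a <= c * a)%g.
Proof.
move=> bc; rewrite -(cjoin_pair bc) mul_cjoinl.
by apply: cjoin_ub; exists b => //; left.
Qed.

Lemma le_ldiv a b c : (c <= ldiv a b) = (a * c <= b)%g.
Proof.
apply/idP/idP => [h|]; last exact: cjoin_ub.
apply: (le_trans (qmul_le2l a h)); rewrite mul_cjoinr.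
by apply: cjoin_least => _ [x xP <-].
Qed.

Lemma le_rdiv a b c : (c <= rdiv b a) = (c * a <= b)%g.
Proof.
apply/idP/idP => [h|]; last exact: cjoin_ub.
apply: (le_trans (qmul_le2r a h)); rewrite mul_cjoinl.
by apply: cjoin_least => _ [x xP <-].
Qed.

End QuantaleTheory.

Section DivisibleTheory.
Context {d : Order.disp_t} {Q : divQuantaleType d}.
Implicit Types a b c x y : Q.

Lemma top_is_unit : \top = 1%g :> Q.
Proof.
have [[x xT] _] := divisible _ _ (lex1 (1%g : Q)).
have h : (\top * \top)%g = \top :> Q.
  apply/le_anti; rewrite lex1 /=.
  by rewrite -{1}[\top](mulg1 (\top : Q)) qmul_le2l // lex1.
by rewrite -xT -{2}h mulgA xT mul1g.
Qed.

Lemma qle1 a : a <= 1%g.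
Proof. by rewrite -top_is_unit lex1. Qed.

Lemma mul_ldiv a b : a <= b -> (b * ldiv b a)%g = a.
Proof.
move=> ab; apply/le_anti; rewrite -le_ldiv lexx /=.
by have [_ [y <-]] := divisible _ _ ab; rewrite qmul_le2l // le_ldiv.
Qed.

Lemma rdiv_mul a b : a <= b -> (rdiv a b * b)%g = a.
Proof.
move=> ab; apply/le_anti; rewrite -le_rdiv lexx /=.
by have [[x <-] _] := divisible _ _ ab; rewrite qmul_le2r // le_rdiv.
Qed.

End DivisibleTheory.

(* The arrows X -> Y of the quantaloid are the a in Q with a <= X /\ Y; order
   and joins are inherited from Q, but the top element is X /\ Y. *)
Record qhom d (Q : divQuantaleType d) (X Y : Q) :=
  QHom { qval : Q; qvalP : qval <= X `&` Y }.
Coercion qval : qhom >-> DivQuantale.sort.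

HB.instance Definition _ d (Q : divQuantaleType d) (X Y : Q) :=
  [isSub for @qval d Q X Y].
HB.instance Definition _ d (Q : divQuantaleType d) (X Y : Q) :=
  [Choice of qhom X Y by <:].
HB.instance Definition _ d (Q : divQuantaleType d) (X Y : Q) :=
  [SubChoice_isSubPOrder of qhom X Y by <: with d].

Section QHomLattice.
Context {d : Order.disp_t} {Q : divQuantaleType d} {X Y : Q}.
Implicit Types a b : qhom X Y.

Lemma qhom_eq a b : qval a = qval b -> a = b.
Proof. exact: val_inj. Qed.

Lemma qhom_leE a b : (a <= b) = (qval a <= qval b).
Proof. by []. Qed.

Lemma qval_le_src a : qval a <= X.
Proof. exact: le_trans (qvalP a) (leIl _ _). Qed.

Lemma qval_le_tgt a : qval a <= Y.
Proof. exact: le_trans (qvalP a) (leIr _ _). Qed.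

Fact qhom_meet_le a b : qval a `&` qval b <= X `&` Y.
Proof. exact: le_trans (leIl _ _) (qvalP a). Qed.

Fact qhom_join_le a b : qval a `|` qval b <= X `&` Y.
Proof. by rewrite leUx !qvalP. Qed.

Fact qhom_meetP (x y z : qhom X Y) :
  (x <= QHom (qhom_meet_le y z)) = (x <= y) && (x <= z).
Proof. by rewrite !qhom_leE lexI. Qed.

Fact qhom_joinP (x y z : qhom X Y) :
  (QHom (qhom_join_le x y) <= z) = (x <= z) && (y <= z).
Proof. by rewrite !qhom_leE leUx. Qed.

HB.instance Definition _ := Order.POrder_MeetJoin_isLattice.Build d (qhom X Y)
  qhom_meetP qhom_joinP.

Fact qhom_bot_min a : QHom (le0x (X `&` Y)) <= a.
Proof. by rewrite qhom_leE le0x. Qed.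

Fact qhom_top_max a : a <= QHom (lexx (X `&` Y)).
Proof. by rewrite qhom_leE qvalP. Qed.

HB.instance Definition _ := Order.hasBottom.Build d (qhom X Y) qhom_bot_min.
HB.instance Definition _ := Order.hasTop.Build d (qhom X Y) qhom_top_max.

Fact qhom_cjoin_le (S : set (qhom X Y)) :
  cjoin [set qval a | a in S] <= X `&` Y.
Proof. by apply: cjoin_least => _ [a _ <-]; exact: qvalP. Qed.

Fact qhom_cjoinP (S : set (qhom X Y)) : supremums S (QHom (qhom_cjoin_le S)).
Proof.
split=> [a Sa|b Sb]; rewrite qhom_leE /=; first by apply: cjoin_ub; exists a.
by apply: cjoin_least => _ [a Sa <-]; exact: Sb.
Qed.

HB.instance Definition _ :=
  TBLattice_isComplete.Build d (qhom X Y) qhom_cjoinP.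

Lemma qval_cjoin (S : set (qhom X Y)) :
  qval (cjoin S) = cjoin [set qval a | a in S].
Proof. by []. Qed.

End QHomLattice.

Section Quantaloid.
Context {d : Order.disp_t} {Q : divQuantaleType d}.
Implicit Types X Y Z W : Q.

Fact hcomp_le X Y Z (b : qhom Y Z) (a : qhom X Y) :
  (qval b * ldiv Y (qval a))%g <= X `&` Z.
Proof.
rewrite lexI; apply/andP; split; last first.
  apply: le_trans (qval_le_tgt b).
  by rewrite -[leRHS]mulg1 qmul_le2l // qle1.
rewrite -(rdiv_mul (qval_le_src b)) -mulgA (mul_ldiv (qval_le_tgt a)).
apply: le_trans (qval_le_src a).
by rewrite -[leRHS]mul1g qmul_le2r // qle1.
Qed.

(* b ∘ a = b & (Y \ a), which is also (b / Y) & a by hcompE' below. *)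
Definition hcomp X Y Z (b : qhom Y Z) (a : qhom X Y) : qhom X Z :=
  QHom (hcomp_le b a).

Fact hid_le X : X <= X `&` X.
Proof. by rewrite meetxx. Qed.

Definition hid X : qhom X X := QHom (hid_le X).

(* The largest g with g ∘ f <= h, by le_hext below. *)
Definition hext X Y Z (h : qhom X Z) (f : qhom X Y) : qhom Y Z :=
  cjoin [set g : qhom Y Z | hcomp g f <= h].

End Quantaloid.

Notation "b ∘ a" := (hcomp b a)
  (at level 40, left associativity) : quantaloid_scope.
Notation "h ↙ f" := (hext h f) (at level 40, no associativity)
  : quantaloid_scope.

Section QuantaloidTheory.
Context {d : Order.disp_t} {Q : divQuantaleType d}.
Implicit Types X Y Z W : Q.

Lemma hcompE X Y Z (b : qhom Y Z) (a : qhom X Y) :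
  qval (b ∘ a) = (qval b * ldiv Y (qval a))%g.
Proof. by []. Qed.

Lemma hcompE' X Y Z (b : qhom Y Z) (a : qhom X Y) :
  qval (b ∘ a) = (rdiv (qval b) Y * qval a)%g.
Proof.
rewrite hcompE -{1}(rdiv_mul (qval_le_src b)) -mulgA.
by rewrite (mul_ldiv (qval_le_tgt a)).
Qed.

Lemma hcompA X Y Z W (c : qhom Z W) (b : qhom Y Z) (a : qhom X Y) :
  c ∘ (b ∘ a) = c ∘ b ∘ a.
Proof.
apply: qhom_eq.
by rewrite hcompE' (hcompE b a) (hcompE (c ∘ b) a) (hcompE' c b) mulgA.
Qed.

Lemma hcomp1l X Y (a : qhom X Y) : hid Y ∘ a = a.
Proof. by apply: qhom_eq; rewrite hcompE /= (mul_ldiv (qval_le_tgt a)). Qed.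

Lemma hcomp1r X Y (a : qhom X Y) : a ∘ hid X = a.
Proof. by apply: qhom_eq; rewrite hcompE' /= (rdiv_mul (qval_le_src a)). Qed.

Lemma hcomp_cjoinl X Y Z (S : set (qhom Y Z)) (a : qhom X Y) :
  cjoin S ∘ a = cjoin [set b ∘ a | b in S].
Proof.
apply: qhom_eq; rewrite hcompE !qval_cjoin mul_cjoinl; congr cjoin.
apply/seteqP; split=> [_ [_ [b Sb <-] <-]|_ [_ [b Sb <-] <-]].
  by exists (b ∘ a) => //; exists b.
by exists (qval b) => //; exists b.
Qed.

Lemma hcomp_cjoinr X Y Z (b : qhom Y Z) (S : set (qhom X Y)) :
  b ∘ cjoin S = cjoin [set b ∘ a | a in S].
Proof.
apply: qhom_eq; rewrite hcompE' !qval_cjoin mul_cjoinr; congr cjoin.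
apply/seteqP; split=> [_ [_ [a Sa <-] <-]|_ [_ [a Sa <-] <-]].
  by exists (b ∘ a); [exists a|rewrite hcompE'].
by exists (qval a); [exists a|rewrite hcompE'].
Qed.

Lemma hcomp_le2l X Y Z (b : qhom Y Z) (a a' : qhom X Y) :
  a <= a' -> b ∘ a <= b ∘ a'.
Proof. by rewrite !qhom_leE !hcompE'; exact: qmul_le2l. Qed.

Lemma hcomp_le2r X Y Z (b b' : qhom Y Z) (a : qhom X Y) :
  b <= b' -> b ∘ a <= b' ∘ a.
Proof. by rewrite !qhom_leE !hcompE; exact: qmul_le2r. Qed.

Lemma le_hext X Y Z (h : qhom X Z) (f : qhom X Y) (g : qhom Y Z) :
  (g <= h ↙ f) = (g ∘ f <= h).
Proof.
apply/idP/idP => [gh|]; last exact: cjoin_ub.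
apply: (le_trans (hcomp_le2r f gh)); rewrite hcomp_cjoinl.
by apply: cjoin_least => _ [k kP <-].
Qed.

Lemma hcomp_mono (X X' Y Y' Z Z' : Q) (b : qhom Y Z) (a : qhom X Y)
    (b' : qhom Y' Z') (a' : qhom X' Y') :
  Y = Y' -> b <= b' :> Q -> a <= a' :> Q -> b ∘ a <= b' ∘ a' :> Q.
Proof.
move=> YY'; subst Y' => bb' aa'; rewrite !hcompE.
apply: (@le_trans _ _ (qval b' * ldiv Y (qval a))%g); first exact: qmul_le2r.
by apply: qmul_le2l; rewrite le_ldiv; apply: le_trans aa'; rewrite -le_ldiv.
Qed.

End QuantaloidTheory.

Record qcat d (Q : divQuantaleType d) := QCat {
  qob :> Type;
  ty : qob -> Q;
  chom : forall x y : qob, qhom (ty x) (ty y);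
  chom_id : forall x, hid (ty x) <= chom x x;
  chom_comp : forall x y z, chom y z ∘ chom x y <= chom x z
}.

Section QCategories.
Context {d : Order.disp_t} {Q : divQuantaleType d}.
Implicit Types A B C : qcat Q.

(* Hom-arrows of different hom-sets are compared through their values in Q. *)
Record qfun A B := QFun {
  qfun_map :> A -> B;
  qfun_ty : forall x, ty (qfun_map x) = ty x;
  qfun_hom : forall x x',
    chom x x' <= chom (qfun_map x) (qfun_map x') :> Q
}.

Definition qle A (x y : A) : Prop := ty x = ty y /\ hid (ty x) <= chom x y :> Q.

Definition skeletal A : Prop := forall x y : A, qle x y -> qle y x -> x = y.

Definition qfun_le A B (F G : qfun A B) : Prop := forall x, qle (F x) (G x).

Definition qfun_id A : qfun A A :=
  @QFun A A id (fun=> erefl) (fun _ _ => lexx _).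

Fact qfun_comp_ty A B C (G : qfun B C) (F : qfun A B) x : ty (G (F x)) = ty x.
Proof. by rewrite !qfun_ty. Qed.

Fact qfun_comp_hom A B C (G : qfun B C) (F : qfun A B) x x' :
  chom x x' <= chom (G (F x)) (G (F x')) :> Q.
Proof. exact: le_trans (qfun_hom F x x') (qfun_hom G _ _). Qed.

Definition qfun_comp A B C (G : qfun B C) (F : qfun A B) : qfun A C :=
  QFun (qfun_comp_ty G F) (qfun_comp_hom G F).

Definition ladjoint A B (F : qfun A B) (G : qfun B A) : Prop :=
  qfun_le (qfun_id A) (qfun_comp G F) /\ qfun_le (qfun_comp F G) (qfun_id B).

Record dist A B := Dist {
  dval :> forall (x : A) (y : B), qhom (ty x) (ty y);
  dist_tgt : forall x y y', chom y' y ∘ dval x y' <= dval x y;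
  dist_src : forall x x' y, dval x' y ∘ chom x x' <= dval x y
}.

Lemma dist_eq A B (phi psi : dist A B) :
  (forall x y, phi x y = psi x y) -> phi = psi.
Proof.
case: phi psi => f f1 f2 [g g1 g2] /= fg.
have {}fg : f = g.
  by apply: functional_extensionality_dep => x;
     apply: functional_extensionality_dep => y.
by subst g; congr Dist; exact: Prop_irrelevance.
Qed.

Lemma qfun_eq A B (F G : qfun A B) : (forall x, F x = G x) -> F = G.
Proof.
case: F G => f f1 f2 [g g1 g2] /= fg.
have {}fg : f = g by apply: functional_extensionality_dep.
by subst g; congr QFun; exact: Prop_irrelevance.
Qed.

Definition dist_id A : dist A A :=
  @Dist A A (@chom _ _ A) (fun x y y' => chom_comp x y' y)
    (fun x x' y => chom_comp x x' y).

Section Composition.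
Context {A B C : qcat Q}.

Definition dcomp_val (psi : dist B C) (phi : dist A B) (x : A) (z : C) :
    qhom (ty x) (ty z) :=
  cjoin (range (fun y : B => psi y z ∘ phi x y)).

Fact dcomp_tgt psi phi x z z' :
  chom z' z ∘ dcomp_val psi phi x z' <= dcomp_val psi phi x z.
Proof.
rewrite hcomp_cjoinr; apply: cjoin_least => _ [_ [y _ <-] <-].
rewrite hcompA; apply: le_trans (hcomp_le2r _ (dist_tgt psi y z z')) _.
by apply: cjoin_ub; exists y.
Qed.

Fact dcomp_src psi phi x x' z :
  dcomp_val psi phi x' z ∘ chom x x' <= dcomp_val psi phi x z.
Proof.
rewrite hcomp_cjoinl; apply: cjoin_least => _ [_ [y _ <-] <-].
rewrite -hcompA; apply: le_trans (hcomp_le2l _ (dist_src phi x x' y)) _.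
by apply: cjoin_ub; exists y.
Qed.

Definition dcomp (psi : dist B C) (phi : dist A B) : dist A C :=
  Dist (dcomp_tgt psi phi) (dcomp_src psi phi).

Definition dext_val (eta : dist A C) (phi : dist A B) (y : B) (z : C) :
    qhom (ty y) (ty z) :=
  cmeet (range (fun x : A => eta x z ↙ phi x y)).

Lemma le_dext_val eta phi y z (g : qhom (ty y) (ty z)) :
  g <= dext_val eta phi y z <-> forall x, g ∘ phi x y <= eta x z.
Proof.
split=> [h x|h].
  by rewrite -le_hext; apply: le_trans h _; apply: cmeet_lb; exists x.
by apply: cmeet_greatest => _ [x _ <-]; rewrite le_hext.
Qed.

Fact dext_tgt eta phi y z z' :
  chom z' z ∘ dext_val eta phi y z' <= dext_val eta phi y z.
Proof.
apply/le_dext_val => x; rewrite -hcompA.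
apply: le_trans (hcomp_le2l _ _) (dist_tgt eta x z z').
by have /le_dext_val := lexx (dext_val eta phi y z'); apply.
Qed.

Fact dext_src eta phi y y' z :
  dext_val eta phi y' z ∘ chom y y' <= dext_val eta phi y z.
Proof.
apply/le_dext_val => x; rewrite -hcompA.
apply: le_trans (hcomp_le2l _ (dist_tgt phi x y' y)) _.
by have /le_dext_val := lexx (dext_val eta phi y' z); apply.
Qed.

(* The right extension of eta along phi in the quantaloid of distributors. *)
Definition dext (eta : dist A C) (phi : dist A B) : dist B C :=
  Dist (dext_tgt eta phi) (dext_src eta phi).

End Composition.

Fact star_comp (X : Q) (x y z : unit) : hid X ∘ hid X <= hid X.
Proof. by rewrite hcomp1l. Qed.

Definition star (X : Q) : qcat Q :=
  @QCat d Q unit (fun=> X) (fun _ _ => hid X) (fun=> lexx _) (@star_comp X).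

(* Presheaves of all types X at once; [pty] is the type X. *)
Record presheaf A := Presheaf { pty : Q; pdist :> dist A (star pty) }.

Definition phom A (mu lam : presheaf A) : qhom (pty mu) (pty lam) :=
  dext lam mu tt tt.

Lemma le_phom A (mu lam : presheaf A) (g : qhom (pty mu) (pty lam)) :
  g <= phom mu lam <-> forall x, g ∘ mu x tt <= lam x tt.
Proof. exact: (@le_dext_val _ _ _ lam mu tt tt g). Qed.

Fact phom_id A (mu : presheaf A) : hid (pty mu) <= phom mu mu.
Proof. by apply/le_phom => x; rewrite hcomp1l. Qed.

Fact phom_comp A (mu lam nu : presheaf A) :
  phom lam nu ∘ phom mu lam <= phom mu nu.
Proof.
apply/le_phom => x; rewrite -hcompA.
have /le_phom /(_ x) h1 := lexx (phom mu lam).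
have /le_phom /(_ x) h2 := lexx (phom lam nu).
exact: le_trans (hcomp_le2l _ h1) h2.
Qed.

Definition PA A : qcat Q :=
  @QCat d Q (presheaf A) (@pty A) (@phom A) (@phom_id A) (@phom_comp A).

(* A(a,-) = A ↙ mu, both being distributors from a one-object category to A. *)
Definition complete A : Prop := forall mu : presheaf A, exists a : A,
  ty a = pty mu /\ forall y : A, chom a y = dext (dist_id A) mu tt y :> Q.

Definition qsub A (P : set A) : qcat Q :=
  @QCat d Q {x : A | P x} (fun x => ty (sval x))
    (fun x y => chom (sval x) (sval y)) (fun x => chom_id (sval x))
    (fun x y z => chom_comp (sval x) (sval y) (sval z)).

(* phi^*(lam) = lam ∘ phi and phi_*(mu) = mu ↙ phi. *)
Definition up A B (phi : dist A B) (lam : presheaf B) : presheaf A :=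
  Presheaf (dcomp lam phi).
Definition low A B (phi : dist A B) (mu : presheaf A) : presheaf B :=
  Presheaf (dext mu phi).

Section Cograph.
Context {B' B : qcat Q} (G : qfun B' B).

Fact cograph_le (y : B) (y' : B') : qval (chom y (G y')) <= ty y `&` ty y'.
Proof. by rewrite -(qfun_ty G y'); exact: qvalP. Qed.

Definition cograph_val (y : B) (y' : B') : qhom (ty y) (ty y') :=
  QHom (cograph_le y y').

Fact cograph_tgt y y' y'' :
  chom y'' y' ∘ cograph_val y y'' <= cograph_val y y'.
Proof.
have := chom_comp y (G y'') (G y'); rewrite !qhom_leE; apply: le_trans.
by apply: hcomp_mono => //; [rewrite qfun_ty|exact: qfun_hom].
Qed.

Fact cograph_src x y y' : cograph_val y y' ∘ chom x y <= cograph_val x y'.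
Proof. exact: chom_comp x y (G y'). Qed.

(* G^♮(y,y') = B(y,Gy'). *)
Definition cograph : dist B B' := Dist cograph_tgt cograph_src.

(* G^→(mu) = mu ∘ G^♮. *)
Definition pushforward (mu : presheaf B') : presheaf B :=
  Presheaf (dcomp mu cograph).

End Cograph.

(* K(phi): the full subcategory of PB on the fixed points of phi_* . phi^*. *)
Definition Klat A B (phi : dist A B) : qcat Q :=
  @qsub (PA B) [set lam | low phi (up phi lam) = lam].

End QCategories.

Record category := Category {
  ob :> Type;
  mor : ob -> ob -> Type;
  idc : forall X, mor X X;
  cmp : forall X Y Z, mor Y Z -> mor X Y -> mor X Z;
  cmp1l : forall X Y (f : mor X Y), cmp (idc Y) f = f;
  cmp1r : forall X Y (f : mor X Y), cmp f (idc X) = f;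
  cmpA : forall W X Y Z (h : mor Y Z) (g : mor X Y) (f : mor W X),
    cmp h (cmp g f) = cmp (cmp h g) f
}.

Definition opcat (C : category) : category :=
  @Category C (fun X Y => mor Y X) (@idc C) (fun X Y Z g f => cmp f g)
    (fun X Y f => cmp1r f) (fun X Y f => cmp1l f)
    (fun W X Y Z h g f => esym (cmpA f g h)).

Definition fullsub (C : category) (O : Type) (i : O -> C) : category :=
  @Category O (fun X Y => mor (i X) (i Y)) (fun X => idc (i X))
    (fun X Y Z g f => cmp g f) (fun X Y f => cmp1l f)
    (fun X Y f => cmp1r f) (fun W X Y Z h g f => cmpA h g f).

(* Functors with a prescribed action on objects. *)
Record functor (C D : category) (Fo : C -> D) := Functor {
  fmor :> forall X Y : C, mor X Y -> mor (Fo X) (Fo Y);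
  fmor_id : forall X : C, fmor (idc X) = idc (Fo X);
  fmor_cmp : forall (X Y Z : C) (g : mor Y Z) (f : mor X Y),
    fmor (cmp g f) = cmp (fmor g) (fmor f)
}.

Definition is_iso (C : category) (X Y : C) (f : mor X Y) : Prop :=
  exists g : mor Y X, cmp g f = idc X /\ cmp f g = idc Y.

Record ccat_ob d (Q : divQuantaleType d) := CCatOb {
  ccat_qcat :> qcat Q;
  ccat_cond : skeletal ccat_qcat /\ complete ccat_qcat
}.

Section CCat.
Context {d : Order.disp_t} (Q : divQuantaleType d).

Record ccat_mor (A B : ccat_ob Q) := CCatMor {
  ccat_fun :> qfun A B;
  ccat_ladj : exists G : qfun B A, ladjoint ccat_fun G
}.

Lemma ccat_mor_eq (A B : ccat_ob Q) (F G : ccat_mor A B) :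
  (forall x, F x = G x) -> F = G.
Proof.
case: F G => f f1 [g g1] /= fg.
have {}fg : f = g by apply: qfun_eq.
by subst g; congr CCatMor; exact: Prop_irrelevance.
Qed.

Lemma qle_refl (A : qcat Q) (x : A) : qle x x.
Proof. by split=> //; exact: chom_id. Qed.

Lemma qle_trans (A : qcat Q) (x y z : A) : qle x y -> qle y z -> qle x z.
Proof.
move=> [txy hxy] [tyz hyz]; split; first by rewrite txy.
have := chom_comp x y z; rewrite qhom_leE; apply: le_trans.
rewrite -[hid (ty x)]hcomp1l; apply: hcomp_mono => //.
by apply: le_trans hyz; rewrite /= txy.
Qed.

Lemma qfun_mono (A B : qcat Q) (F : qfun A B) (x y : A) :
  qle x y -> qle (F x) (F y).
Proof.
move=> [txy hxy]; split; first by rewrite !qfun_ty.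
by apply: le_trans (qfun_hom F x y); rewrite /= qfun_ty.
Qed.

Fact ladjoint_id (A : qcat Q) : exists G : qfun A A, ladjoint (qfun_id A) G.
Proof. by exists (qfun_id A); split=> x; exact: qle_refl. Qed.

Fact ladjoint_comp (A B C : qcat Q) (F' : qfun B C) (F : qfun A B) :
  (exists G, ladjoint F G) -> (exists G, ladjoint F' G) ->
  exists G, ladjoint (qfun_comp F' F) G.
Proof.
move=> [G [u c]] [G' [u' c']]; exists (qfun_comp G G'); split=> x.
  exact: qle_trans (u x) (qfun_mono G (u' (F x))).
exact: qle_trans (qfun_mono F' (c (G' x))) (c' x).
Qed.

Definition ccat_id (A : ccat_ob Q) : ccat_mor A A := CCatMor (ladjoint_id A).

Definition ccat_comp (A B C : ccat_ob Q)
    (G : ccat_mor B C) (F : ccat_mor A B) : ccat_mor A C :=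
  CCatMor (ladjoint_comp (ccat_ladj F) (ccat_ladj G)).

Definition CCat : category.
Proof.
refine (@Category (ccat_ob Q) ccat_mor ccat_id ccat_comp _ _ _) => *;
  exact: ccat_mor_eq.
Defined.

End CCat.

Record info_ob d (Q : divQuantaleType d) := InfoOb {
  info_src : qcat Q;
  info_tgt : qcat Q;
  info_dist :> dist info_src info_tgt
}.

Record qsubset d (Q : divQuantaleType d) := QSubset {
  qset :> Type;
  qmem : qset -> Q
}.

Section Info.
Context {d : Order.disp_t} (Q : divQuantaleType d).

Record info_mor (phi psi : info_ob Q) := InfoMor {
  info_fst : qfun (info_src phi) (info_src psi);
  info_snd : qfun (info_tgt psi) (info_tgt phi);
  info_eq : forall x y', phi x (info_snd y') = psi (info_fst x) y' :> Q
}.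

Lemma info_mor_eq (phi psi : info_ob Q) (f g : info_mor phi psi) :
  (forall x, info_fst f x = info_fst g x) ->
  (forall y, info_snd f y = info_snd g y) -> f = g.
Proof.
case: f g => F G e [F' G' e'] /= /qfun_eq FF' /qfun_eq GG'.
by subst F' G'; congr InfoMor; exact: Prop_irrelevance.
Qed.

Definition info_id (phi : info_ob Q) : info_mor phi phi :=
  @InfoMor phi phi (qfun_id _) (qfun_id _) (fun _ _ => erefl).

Fact info_comp_eq (phi psi chi : info_ob Q)
    (g : info_mor psi chi) (f : info_mor phi psi) x y :
  phi x (info_snd f (info_snd g y)) = chi (info_fst g (info_fst f x)) y :> Q.
Proof. by rewrite !info_eq. Qed.

Definition info_comp (phi psi chi : info_ob Q)
    (g : info_mor psi chi) (f : info_mor phi psi) : info_mor phi chi :=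
  @InfoMor phi chi (qfun_comp (info_fst g) (info_fst f))
    (qfun_comp (info_snd f) (info_snd g)) (info_comp_eq g f).

Definition Info : category.
Proof.
refine (@Category (info_ob Q) info_mor info_id info_comp _ _ _) => *;
  exact: info_mor_eq.
Defined.

Fact disc_le (A : qsubset Q) (x y : A) :
  (if `[< x = y >] then qmem x else \bot) <= qmem x `&` qmem y.
Proof. by case: asboolP => [<-|_]; rewrite ?meetxx ?le0x. Qed.

Definition disc_hom (A : qsubset Q) (x y : A) : qhom (qmem x) (qmem y) :=
  QHom (disc_le x y).

Fact disc_id (A : qsubset Q) (x : A) : hid (qmem x) <= disc_hom x x.
Proof. by rewrite qhom_leE /=; case: asboolP. Qed.

Fact disc_comp (A : qsubset Q) (x y z : A) :
  disc_hom y z ∘ disc_hom x y <= disc_hom x z.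
Proof.
have [xy|xy] := asboolP (x = y).
  by subst y; rewrite -[leRHS]hcomp1r; apply/hcomp_le2l/qval_le_src.
have -> : disc_hom x y = cjoin set0.
  apply: qhom_eq; rewrite /= asboolF //; apply/le_anti; rewrite le0x /=.
  by apply: cjoin_least => ? [].
by rewrite hcomp_cjoinr; apply: cjoin_least => _ [? []].
Qed.

Definition disc (A : qsubset Q) : qcat Q :=
  @QCat d Q A (@qmem d Q A) (@disc_hom A) (@disc_id A) (@disc_comp A).

Record fcontext := FContext {
  ctx_src : qsubset Q;
  ctx_tgt : qsubset Q;
  ctx_dist : dist (disc ctx_src) (disc ctx_tgt)
}.

Definition info_of_ctx (c : fcontext) : Info := InfoOb (ctx_dist c).

Definition Ctx : category := fullsub info_of_ctx.

(* (mu, lam) with lam = phi_*(mu) and mu = phi^*(lam); the equations force mu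
   and lam to have the same type. *)
Record concept (c : fcontext) := Concept {
  extent : presheaf (disc (ctx_src c));
  intent : presheaf (disc (ctx_tgt c));
  intentE : intent = low (ctx_dist c) extent;
  extentE : extent = up (ctx_dist c) intent
}.

Definition ConceptLattice (c : fcontext) : qcat Q :=
  @QCat d Q (concept c) (fun p => pty (extent p))
    (fun p q => phom (extent p) (extent q)) (fun p => phom_id (extent p))
    (fun p q r => phom_comp (extent p) (extent q) (extent r)).

End Info.

(* Main.v *)
(* The adjunctions [up phi -| low phi] and [pushforward G -| pullback G] make
    [low phi (up phi (pushforward G lam))] the left adjoint of the restriction
    of [pullback G] to fixed points: the equation phi(x, Gy') = psi(Fx, y')
    says exactly enough for [pullback G] to preserve them. Since
    [pullback] is strictly functorial and left adjoints into a skeletal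
    category are unique, functoriality of K on Q-Info follows. Both lattices
    are full reflective subcategories of a presheaf category, hence skeletal
    and complete, and the functor on Q-Ctx is the conjugate of the one on
    Q-Info by the isomorphism (mu, lam) |-> lam. *)
Require Import Defs.
From mathcomp Require Import all_boot all_order.
From mathcomp Require Import boolp classical_sets.

Set Implicit Arguments.
Unset Strict Implicit.
Unset Printing Implicit Defensive.

Import Order.TTheory.
Local Open Scope order_scope.
Local Open Scope quantaloid_scope.

(** * Presheaves, adjunctions, and the closure [low phi (up phi lam)] *)

Section Presheaves.
Context {d : Order.disp_t} {Q : divQuantaleType d}.
Implicit Types A B C : qcat Q.

Lemma qhom_ext (X Y : Q) (a b : qhom X Y) :
  (forall g : qhom X Y, g <= a <-> g <= b) -> a = b.
Proof. by move=> h; apply/le_anti/andP; split; apply/h. Qed.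

Lemma le_dcomp A B C (psi : dist B C) (phi : dist A B) x y z :
  psi y z ∘ phi x y <= dcomp psi phi x z.
Proof. by apply: cjoin_ub; exists y. Qed.

Lemma hcomp_dcomp_le A B C (psi : dist B C) (phi : dist A B) x z W
    (g : qhom (ty z) W) (h : qhom (ty x) W) :
  g ∘ dcomp psi phi x z <= h <-> forall y, g ∘ psi y z ∘ phi x y <= h.
Proof.
split=> [gh y|gh].
  by rewrite -hcompA; apply: le_trans gh; apply/hcomp_le2l/le_dcomp.
rewrite hcomp_cjoinr; apply: cjoin_least => _ [_ [y _ <-] <-].
by rewrite hcompA.
Qed.

(** Values are compared in [Q] because presheaves of different types take values in different
    hom-sets; no transport along the type equation is needed. *)
Lemma presheaf_eq A (mu lam : presheaf A) :
  pty mu = pty lam -> (forall x, mu x tt = lam x tt :> Q) -> mu = lam.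
Proof.
case: mu lam => X mu [Y lam] /= XY; subst Y => ml.
by congr Presheaf; apply: dist_eq => x []; apply: qhom_eq; exact: ml.
Qed.

(** Once the types are identified, the underlying order of presheaves is the pointwise one. *)
Lemma PA_skeletal A : skeletal (PA A).
Proof.
move=> [X mu] [Y lam] [/= XY]; subst Y => h1 [_ h2].
have {}h1 := (@le_phom _ _ _ (Presheaf mu) (Presheaf lam) (hid X)).1 h1.
have {}h2 := (@le_phom _ _ _ (Presheaf lam) (Presheaf mu) (hid X)).1 h2.
apply: presheaf_eq => //= x; apply/le_anti/andP; split.
  by have := h1 x; rewrite hcomp1l.
by have := h2 x; rewrite hcomp1l.
Qed.

(** Unit and counit come from the equation at [b = F a] and at [a = G b], where one side dominates
    an identity. *)
Lemma ladjoint_hom A B (F : qfun A B) (G : qfun B A) :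
  (forall a b, chom (F a) b = chom a (G b) :> Q) -> ladjoint F G.
Proof.
move=> FG; split=> x; split; rewrite /= ?qfun_ty //.
  by rewrite -FG -(qfun_ty F x); exact: chom_id.
by rewrite FG (qfun_ty F (G x)); exact: chom_id.
Qed.

Lemma ladjoint_cancel A B (F : qfun A B) (G : qfun B A) :
  cancel F G -> cancel G F -> ladjoint F G.
Proof.
by move=> FK GK; split=> x; rewrite /qfun_comp /= ?FK ?GK; exact: qle_refl.
Qed.

Lemma ladjoint_trans A B C (F' : qfun B C) (F : qfun A B)
    (G : qfun B A) (G' : qfun C B) :
  ladjoint F G -> ladjoint F' G' ->
  ladjoint (qfun_comp F' F) (qfun_comp G G').
Proof.
move=> [u c] [u' c']; split=> x.
  exact: qle_trans (u x) (qfun_mono G (u' (F x))).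
exact: qle_trans (qfun_mono F' (c (G' x))) (c' x).
Qed.

(** [F a <= F (G' (F' a)) = F (G (F' a)) <= F' a], and symmetrically. *)
Lemma ladjoint_unique A B (F F' : qfun A B) (G G' : qfun B A) :
  skeletal B -> ladjoint F G -> ladjoint F' G' -> (forall b, G b = G' b) ->
  forall a, F a = F' a.
Proof.
move=> skB [u c] [u' c'] GG' a; apply: skB.
  have := qfun_mono F (u' a); rewrite /= -GG' => h.
  exact: qle_trans h (c (F' a)).
have := qfun_mono F' (u a); rewrite /= GG' => h.
exact: qle_trans h (c' (F a)).
Qed.

Lemma le_low A B (phi : dist A B) (mu : presheaf A) y
    (g : qhom (ty y) (pty mu)) :
  g <= low phi mu y tt <-> forall x, g ∘ phi x y <= mu x tt.
Proof. exact: (@le_dext_val _ _ _ _ _ mu phi y tt g). Qed.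

#[local] Arguments le_low {A B} phi mu y g.

Lemma le_phom_up A B (phi : dist A B) (lam : presheaf B) (mu : presheaf A)
    (g : qhom (pty lam) (pty mu)) :
  g <= phom (up phi lam) mu <->
  forall x y, g ∘ lam y tt ∘ phi x y <= mu x tt.
Proof.
apply: (iff_trans (@le_phom _ _ _ (up phi lam) mu g)).
have E x := @hcomp_dcomp_le _ _ _ lam phi x tt (pty mu) g (mu x tt).
by split=> h x; apply/E; exact: h.
Qed.

Lemma le_phom_low A B (phi : dist A B) (lam : presheaf B) (mu : presheaf A)
    (g : qhom (pty lam) (pty mu)) :
  g <= phom lam (low phi mu) <->
  forall x y, g ∘ lam y tt ∘ phi x y <= mu x tt.
Proof.
apply: (iff_trans (@le_phom _ _ _ lam (low phi mu) g)).
have E y := le_low phi mu y (g ∘ lam y tt).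
by split=> [h x y|h y]; [apply: (E y).1 | apply: (E y).2].
Qed.

#[local] Arguments le_phom_up {A B} phi lam mu g.
#[local] Arguments le_phom_low {A B} phi lam mu g.

(** This is the adjunction of [up phi] and [low phi] in hom form: both hom-arrows have as lower
    bounds the [g] with [g ∘ lam y tt ∘ phi x y <= mu x tt] for all [x] and [y]. *)
Lemma phom_up_low A B (phi : dist A B) (lam : presheaf B) (mu : presheaf A) :
  phom (up phi lam) mu = phom lam (low phi mu).
Proof.
apply: qhom_ext => g.
exact: iff_trans (le_phom_up phi lam mu g) (iff_sym (le_phom_low phi lam mu g)).
Qed.

Lemma phom_low A B (phi : dist A B) (mu nu : presheaf A) :
  phom mu nu <= phom (low phi mu) (low phi nu).
Proof.
apply: (le_phom_low phi (low phi mu) nu _).2 => x y; rewrite -hcompA.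
apply: le_trans ((@le_phom _ _ _ mu nu _).1 (lexx _) x).
apply: hcomp_le2l.
exact: (le_low phi mu y _).1 (lexx _) x.
Qed.

Lemma phom_up A B (phi : dist A B) (lam kap : presheaf B) :
  phom lam kap <= phom (up phi lam) (up phi kap).
Proof.
apply: (le_phom_up phi lam (up phi kap) _).2 => x y.
have h := (@le_phom _ _ _ lam kap _).1 (lexx _) y.
by apply: le_trans (hcomp_le2r _ h) _; exact: le_dcomp.
Qed.

Lemma le_closure A B (phi : dist A B) (lam : presheaf B) y :
  lam y tt <= low phi (up phi lam) y tt.
Proof.
by apply: (le_low phi (up phi lam) y _).2 => x; exact: le_dcomp.
Qed.

(** The closure is a reflection onto the image of [low phi]. Stated with an equation for [kap], this
    applies both to fixed points, with [mu = up phi kap], and to intents, with [mu] the extent. *)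
Lemma phom_closure A B (phi : dist A B) (lam kap : presheaf B) mu :
  kap = low phi mu -> phom (low phi (up phi lam)) kap = phom lam kap.
Proof.
move=> ->; apply/le_anti/andP; split.
  apply: (@le_phom _ _ _ lam (low phi mu) _).2 => y.
  apply: le_trans (hcomp_le2l _ (le_closure phi lam y)) _.
  exact: (@le_phom _ _ _ (low phi (up phi lam)) (low phi mu) _).1 (lexx _) y.
by rewrite -(phom_up_low phi lam mu); exact: phom_low.
Qed.

(** One inequality is the reflection property applied to the identity of [low phi mu], the other is
    [le_closure]. *)
Lemma low_up_low A B (phi : dist A B) (mu : presheaf A) :
  low phi (up phi (low phi mu)) = low phi mu.
Proof.
apply: PA_skeletal; split=> //.
  apply: le_trans (chom_id (low phi mu : PA B)) _.
  by rewrite /= (phom_closure (low phi mu) (erefl (low phi mu))).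
apply: (@le_phom _ _ _ (low phi mu) (low phi (up phi (low phi mu))) _).2 => y.
rewrite hcomp1l; exact: (le_closure phi (low phi mu)).
Qed.

Fact pullback_le A B (G : qfun A B) (lam : presheaf B) (x : A) :
  qval (lam (G x) tt) <= ty x `&` pty lam.
Proof. by rewrite -(qfun_ty G x); exact: qvalP. Qed.

(** [G] preserves types only up to a propositional equation, so the value at [G x] is rebuilt as an
    arrow out of [ty x]. *)
Definition pullback_val A B (G : qfun A B) (lam : presheaf B)
    (x : A) (u : star (pty lam)) : qhom (ty x) (ty u) :=
  QHom (pullback_le G lam x).

#[local] Arguments pullback_val {A B} G lam x u.

Fact pullback_tgt A B (G : qfun A B) (lam : presheaf B) x u v :
  chom v u ∘ pullback_val G lam x v <= pullback_val G lam x u.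
Proof. by rewrite [leLHS]hcomp1l. Qed.

Fact pullback_src A B (G : qfun A B) (lam : presheaf B) x y u :
  pullback_val G lam y u ∘ chom x y <= pullback_val G lam x u.
Proof.
have := dist_src lam (G x) (G y) tt; rewrite !qhom_leE; apply: le_trans.
by apply: hcomp_mono; rewrite ?qfun_ty //; exact: qfun_hom.
Qed.

(* The presheaf lam ∘ G_♮, whose value at x is lam (G x). *)
Definition pullback A B (G : qfun A B) (lam : presheaf B) : presheaf A :=
  Presheaf (Dist (@pullback_tgt A B G lam) (@pullback_src A B G lam)).

Lemma phom_pullback A B (G : qfun A B) (lam kap : presheaf B) :
  phom lam kap <= phom (pullback G lam) (pullback G kap).
Proof.
apply: (@le_phom _ _ _ (pullback G lam) (pullback G kap) _).2 => x.
have := (@le_phom _ _ _ lam kap _).1 (lexx _) (G x).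
by rewrite !qhom_leE; apply: le_trans; exact: hcomp_mono.
Qed.

Lemma phom_pushforward A B (G : qfun A B) (lam : presheaf A) (kap : presheaf B) :
  phom (pushforward G lam) kap = phom lam (pullback G kap).
Proof.
apply: qhom_ext => g; apply: (iff_trans (le_phom_up (cograph G) lam kap g)).
apply: iff_sym; apply: (iff_trans (@le_phom _ _ _ lam (pullback G kap) g)).
split=> [h y x|h y].
  have := dist_src kap y (G x) tt.
  rewrite !qhom_leE; apply: le_trans.
  by apply: hcomp_mono; rewrite ?qfun_ty //; exact: h.
(* A Yoneda argument: at the point [G y] the cograph is the hom-arrow from [G y] to itself, which
   dominates the identity. *)
have := h (G y) y; rewrite !qhom_leE; apply: le_trans.
rewrite -{1}(hcomp1r (g ∘ lam y tt)); apply: hcomp_mono => //.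
by rewrite /= -(qfun_ty G y); exact: chom_id.
Qed.

End Presheaves.

#[local] Arguments le_low {d Q A B} phi mu y g.
#[local] Arguments le_phom_up {d Q A B} phi lam mu g.

(** * Reflective full subcategories of presheaf categories *)

Section Reflection.
Context {d : Order.disp_t} {Q : divQuantaleType d}.
Context {A B : qcat Q} (T : qfun A (PA B)) (R : PA B -> A).
Hypothesis T_ff : forall a b, chom a b = phom (T a) (T b) :> Q.
Hypothesis T_inj : injective T.
Hypothesis R_ty : forall lam, ty (R lam) = pty lam.
Hypothesis R_hom : forall lam a, chom (R lam) a = phom lam (T a) :> Q.

Fact restr_le (y : B) (a : A) : qval (T a y tt) <= ty y `&` ty a.
Proof. by rewrite -(qfun_ty T a); exact: qvalP. Qed.

Definition restr_val (y : B) (a : A) : qhom (ty y) (ty a) :=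
  QHom (restr_le y a).

(** The target [Y] is a variable with an equation so that [g] may be an arrow into [ty b], which
    equals [pty (T b)] only propositionally. *)
Lemma le_phom_restr a (lam : presheaf B) Y (g : qhom (ty a) Y) :
  Y = pty lam ->
  g <= phom (T a) lam :> Q <-> forall y, g ∘ restr_val y a <= lam y tt :> Q.
Proof.
move=> YE; subst Y.
have g_le : qval g <= pty (T a) `&` pty lam.
  by rewrite [pty (T a)](qfun_ty T a); exact: qvalP.
apply: (iff_trans (@le_phom _ _ _ (T a) lam (QHom g_le))).
have E y : QHom g_le ∘ T a y tt = g ∘ restr_val y a.
  by apply/qhom_eq/le_anti/andP; split; apply: hcomp_mono;
    rewrite ?[pty (T a)](qfun_ty T a).
by split=> h y; have := h y; rewrite qhom_leE E.
Qed.

Fact restr_tgt y a b : chom b a ∘ restr_val y b <= restr_val y a.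
Proof.
apply: (le_phom_restr (chom b a) (esym (qfun_ty T a))).1.
by rewrite T_ff.
Qed.

Fact restr_src x y a : restr_val y a ∘ chom x y <= restr_val x a.
Proof.
have := dist_src (T a) x y tt; rewrite !qhom_leE; apply: le_trans.
by apply: hcomp_mono.
Qed.

(** The distributor that corresponds to [T] under the bijection between functors from [A] to [PA B]
    and distributors from [B] to [A]. *)
Definition restr : dist B A := Dist restr_tgt restr_src.

Lemma reflective_skeletal : skeletal A.
Proof.
by move=> x y xy yx; apply: T_inj; apply: PA_skeletal; exact: qfun_mono.
Qed.

(* The supremum of mu is the reflection of the join of the presheaves
   mu(a) ∘ T(a)(-). *)
Lemma reflective_complete : complete A.
Proof.
move=> mu; exists (R (up restr mu)); split=> [|a]; first by rewrite R_ty.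
rewrite R_hom; apply/le_anti/andP; split.
  (* Both inequalities translate into [g ∘ mu b ∘ T b y <= T a y] for all [b] and [y], because [T]
     is fully faithful; [le_a] only adjusts the type of the arrow. *)
  have le_a : qval (phom (up restr mu) (T a)) <= pty mu `&` ty a.
    by rewrite -(qfun_ty T a); exact: qvalP.
  apply: (@le_dext_val _ _ _ _ _ (dist_id A) mu tt a (QHom le_a)).2 => b.
  rewrite qhom_leE [leRHS]T_ff.
  apply: (le_phom_restr _ (esym (qfun_ty T a))).2 => y.
  have := (le_phom_up restr mu (T a) _).1 (lexx _) y b.
  rewrite qhom_leE; apply: le_trans.
  by do 2!apply: hcomp_mono => //.
set g := dext _ _ _ _.
have le_a : qval g <= pty mu `&` pty (T a).
  by rewrite [pty (T a)](qfun_ty T a); exact: qvalP.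
apply: (le_phom_up restr mu (T a) (QHom le_a)).2 => y b.
have := (@le_dext_val _ _ _ _ _ (dist_id A) mu tt a g).1 (lexx _) b.
rewrite qhom_leE [leRHS]T_ff => h.
have := (le_phom_restr _ (esym (qfun_ty T a))).1 h y.
rewrite qhom_leE; apply: le_trans.
by do 2!apply: hcomp_mono => //.
Qed.

End Reflection.

(** * The lattice of fixed points as a reflective subcategory *)

Section Lattices.
Context {d : Order.disp_t} {Q : divQuantaleType d}.
Implicit Types A B C : qcat Q.

Definition fixed A B (phi : dist A B) (lam : presheaf B)
    (h : low phi (up phi lam) = lam) : Klat phi :=
  exist _ lam h.

Definition closure A B (phi : dist A B) (lam : presheaf B) : Klat phi :=
  fixed (low_up_low phi (up phi lam)).

Lemma Klat_eq A B (phi : dist A B) (lam kap : Klat phi) :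
  sval lam = sval kap -> lam = kap.
Proof. by case: lam kap => [lam hl] [kap hk] /= e; exact: eq_exist. Qed.

Lemma closure_hom A B (phi : dist A B) (lam : presheaf B) (kap : Klat phi) :
  chom (closure phi lam) kap = phom lam (sval kap) :> Q.
Proof. by rewrite -(phom_closure lam (esym (svalP kap))). Qed.

Definition Klat_incl A B (phi : dist A B) : qfun (Klat phi) (PA B) :=
  @QFun _ _ (Klat phi) (PA B) (fun lam => sval lam) (fun=> erefl)
    (fun _ _ => lexx _).

Lemma Klat_ccat A B (phi : dist A B) : skeletal (Klat phi) /\ complete (Klat phi).
Proof.
split.
  exact: (reflective_skeletal (T := Klat_incl phi) (@Klat_eq _ _ phi)).
apply: (reflective_complete (T := Klat_incl phi) (R := closure phi)) => //.
exact: closure_hom.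
Qed.

End Lattices.

(** * The functor on infomorphisms *)

Section Morphisms.
Context {d : Order.disp_t} {Q : divQuantaleType d}.
Implicit Types A B C : qcat Q.

Lemma closure_fun_hom (phi psi : info_ob Q) (f : info_mor phi psi)
    (lam kap : Klat psi) :
  chom lam kap <= chom (closure phi (pushforward (info_snd f) (sval lam)))
    (closure phi (pushforward (info_snd f) (sval kap))) :> Q.
Proof.
set G := info_snd f.
apply: le_trans (phom_low phi (up phi (pushforward G (sval lam)))
  (up phi (pushforward G (sval kap)))).
apply: le_trans (phom_up phi (pushforward G (sval lam))
  (pushforward G (sval kap))).
(* [pushforward G] is [up (cograph G)] by definition. *)
exact: phom_up (cograph G) (sval lam) (sval kap).
Qed.

Definition Kinfo_fun (phi psi : info_ob Q) (f : info_mor phi psi) :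
    qfun (Klat psi) (Klat phi) :=
  @QFun _ _ (Klat psi) (Klat phi)
    (fun lam => closure phi (pushforward (info_snd f) (sval lam)))
    (fun=> erefl) (closure_fun_hom f).

(* phi(x, G y') = psi(F x, y') makes the restriction along F of
   psi^*(lam ∘ G_♮) a lower bound of phi^*(lam). *)
Lemma pullback_fixed (phi psi : info_ob Q) (f : info_mor phi psi)
    (lam : Klat phi) :
  low psi (up psi (pullback (info_snd f) (sval lam))) =
    pullback (info_snd f) (sval lam).
Proof.
case: lam => lam lamK /=; set G := info_snd f; set tau := pullback G lam.
apply: PA_skeletal; split=> //; last first.
  apply: (@le_phom _ _ _ tau (low psi (up psi tau)) _).2 => y.
  by rewrite hcomp1l; exact: (le_closure psi tau).
apply: (@le_phom _ _ _ (low psi (up psi tau)) tau _).2 => y.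
(* With [lam] written as [low phi (up phi lam)], the bound can be tested after composition with each
   [phi x (G y)]. *)
rewrite hcomp1l qhom_leE /= -[in leRHS]lamK.
set g := low psi (up psi tau) y tt.
have g_le : qval g <= ty (G y) `&` pty lam.
  by rewrite (qfun_ty G y); exact: qvalP.
apply: (le_low phi (up phi lam) (G y) (QHom g_le)).2 => x.
have := (le_low psi (up psi tau) y _).1 (lexx _) (info_fst f x).
rewrite !qhom_leE => h.
apply: (@le_trans _ _ (qval (g ∘ psi (info_fst f x) y))).
  by apply: hcomp_mono; rewrite ?(qfun_ty G) // info_eq.
apply: le_trans h _.
(* [up psi tau] at [F x] is the join over [z] of [lam (G z)] composed with
   [psi (F x) z = phi x (G z)], and these are among the terms of [up phi lam] at [x]. *)
rewrite qval_cjoin; apply: cjoin_least => _ [_ [z _ <-] <-].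
have := le_dcomp lam phi x (G z) tt; rewrite qhom_leE; apply: le_trans.
by apply: hcomp_mono; rewrite ?(qfun_ty G) // info_eq.
Qed.

Lemma pullback_fun_hom (phi psi : info_ob Q) (f : info_mor phi psi)
    (lam kap : Klat phi) :
  chom lam kap <= chom (fixed (pullback_fixed f lam))
    (fixed (pullback_fixed f kap)) :> Q.
Proof. exact: phom_pullback. Qed.

Definition Kinfo_radj (phi psi : info_ob Q) (f : info_mor phi psi) :
    qfun (Klat phi) (Klat psi) :=
  @QFun _ _ (Klat phi) (Klat psi) (fun lam => fixed (pullback_fixed f lam))
    (fun=> erefl) (pullback_fun_hom f).

Lemma Kinfo_adj (phi psi : info_ob Q) (f : info_mor phi psi) :
  ladjoint (Kinfo_fun f) (Kinfo_radj f).
Proof.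
apply: ladjoint_hom => lam kap; rewrite closure_hom.
by congr qval; exact: phom_pushforward.
Qed.

(** Pulling back only evaluates at [G x], with no join involved, so this law and the next hold value
    by value. *)
Lemma pullback_id A (lam : presheaf A) : pullback (qfun_id A) lam = lam.
Proof. exact: presheaf_eq. Qed.

Lemma pullback_comp A B C (G : qfun B C) (F : qfun A B) (lam : presheaf C) :
  pullback (qfun_comp G F) lam = pullback F (pullback G lam).
Proof. exact: presheaf_eq. Qed.

Definition Kinfo_ob : opcat (Info Q) -> CCat Q :=
  fun phi => CCatOb (Klat_ccat phi).

Definition Kinfo_mor (phi psi : opcat (Info Q)) (f : mor phi psi) :
    mor (Kinfo_ob phi) (Kinfo_ob psi) :=
  @CCatMor _ _ (Kinfo_ob phi) (Kinfo_ob psi) (Kinfo_fun f)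
    (ex_intro _ _ (Kinfo_adj f)).

Lemma Kinfo_mor_id (phi : opcat (Info Q)) :
  Kinfo_mor (idc phi) = idc (Kinfo_ob phi).
Proof.
apply: ccat_mor_eq.
apply: (ladjoint_unique (G' := qfun_id _) (Klat_ccat phi).1 (Kinfo_adj _)).
  by split=> x; exact: qle_refl.
by move=> lam; apply: Klat_eq; exact: pullback_id.
Qed.

Lemma Kinfo_mor_cmp (phi psi chi : opcat (Info Q)) (g : mor psi chi)
    (f : mor phi psi) :
  Kinfo_mor (cmp g f) = cmp (Kinfo_mor g) (Kinfo_mor f).
Proof.
apply: ccat_mor_eq.
apply: (ladjoint_unique (Klat_ccat chi).1 (Kinfo_adj _)
  (ladjoint_trans (Kinfo_adj f) (Kinfo_adj g))).
by move=> lam; apply: Klat_eq; exact: pullback_comp.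
Qed.

Definition Kinfo : functor Kinfo_ob := Functor Kinfo_mor_id Kinfo_mor_cmp.

End Morphisms.

(** * Concept lattices of fuzzy contexts and their identification with fixed points *)

Section Contexts.
Context {d : Order.disp_t} {Q : divQuantaleType d}.
Implicit Types c : fcontext Q.

Lemma intent_ty c (p : ConceptLattice c) : pty (intent p) = ty p.
Proof. by rewrite intentE. Qed.

Lemma intent_hom c (p q : ConceptLattice c) :
  chom p q = phom (intent p) (intent q) :> Q.
Proof.
case: p q => mu lam lamE muE [nu kap kapE nuE]; subst mu nu.
(* [kapE] has [kap] on both sides and cannot be substituted; [E] separates the two occurrences. *)
have E nu mu : nu = low (ctx_dist c) mu ->
    phom (up (ctx_dist c) lam) mu = phom lam nu :> Q.
  by move=> ->; rewrite (phom_up_low (ctx_dist c) lam mu).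
exact: E kapE.
Qed.

Lemma intent_hom_le c (p q : ConceptLattice c) :
  chom p q <= phom (intent p) (intent q) :> Q.
Proof. by rewrite intent_hom. Qed.

Definition intent_fun c : qfun (ConceptLattice c) (PA (disc (ctx_tgt c))) :=
  @QFun _ _ (ConceptLattice c) (PA _) (@intent _ _ c) (@intent_ty c)
    (@intent_hom_le c).

Lemma intent_inj c : injective (@intent _ _ c).
Proof.
move=> [mu lam lamE muE] [nu kap kapE nuE] /= lk; subst mu nu kap.
by congr Concept; exact: Prop_irrelevance.
Qed.

Definition concept_of c (lam : Klat (ctx_dist c)) : ConceptLattice c :=
  @Concept _ _ c (up (ctx_dist c) (sval lam)) (sval lam)
    (esym (svalP lam)) erefl.

(** The embedding goes through intents, where [low] after [up] is a closure and gives a reflection;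
    on extents, [up] after [low] is an interior operator instead. *)
Lemma ConceptLattice_ccat c :
  skeletal (ConceptLattice c) /\ complete (ConceptLattice c).
Proof.
split; first exact: (reflective_skeletal (T := intent_fun c) (@intent_inj c)).
apply: (reflective_complete (T := intent_fun c)
  (R := fun lam => concept_of (closure (ctx_dist c) lam))) => //.
  exact: intent_hom.
by move=> lam p; rewrite intent_hom -(phom_closure lam (intentE p)).
Qed.

Definition Kctx_ob : opcat (Ctx Q) -> CCat Q :=
  fun c => CCatOb (ConceptLattice_ccat c).

Lemma intent_fixed c (p : ConceptLattice c) :
  low (ctx_dist c) (up (ctx_dist c) (intent p)) = intent p.
Proof. by rewrite -extentE -intentE. Qed.

Definition intent_Klat c : qfun (ConceptLattice c) (Klat (ctx_dist c)) :=
  @QFun _ _ (ConceptLattice c) (Klat (ctx_dist c))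
    (fun p => fixed (intent_fixed p)) (@intent_ty c) (@intent_hom_le c).

Lemma concept_of_hom c (lam kap : Klat (ctx_dist c)) :
  chom lam kap <= chom (concept_of lam) (concept_of kap) :> Q.
Proof. by rewrite intent_hom. Qed.

Definition concept_Klat c : qfun (Klat (ctx_dist c)) (ConceptLattice c) :=
  @QFun _ _ (Klat (ctx_dist c)) (ConceptLattice c) (@concept_of c)
    (fun=> erefl) (@concept_of_hom c).

Lemma intent_KlatK c : cancel (intent_Klat c) (concept_Klat c).
Proof. by move=> p; exact: intent_inj. Qed.

Lemma concept_KlatK c : cancel (concept_Klat c) (intent_Klat c).
Proof. by move=> lam; exact: Klat_eq. Qed.

Definition intent_mor (c : Ctx Q) :
    mor (Kctx_ob c : CCat Q) (Kinfo_ob (info_of_ctx c)) :=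
  @CCatMor _ _ (Kctx_ob c) (Kinfo_ob (info_of_ctx c)) (intent_Klat c)
    (ex_intro _ _ (ladjoint_cancel (@intent_KlatK c) (@concept_KlatK c))).

Definition concept_mor (c : Ctx Q) :
    mor (Kinfo_ob (info_of_ctx c) : CCat Q) (Kctx_ob c) :=
  @CCatMor _ _ (Kinfo_ob (info_of_ctx c)) (Kctx_ob c) (concept_Klat c)
    (ex_intro _ _ (ladjoint_cancel (@concept_KlatK c) (@intent_KlatK c))).

Lemma intent_morK c : cmp (concept_mor c) (intent_mor c) = idc (Kctx_ob c).
Proof. by apply: ccat_mor_eq; exact: intent_KlatK. Qed.

Lemma concept_morK c :
  cmp (intent_mor c) (concept_mor c) = idc (Kinfo_ob (info_of_ctx c)).
Proof. by apply: ccat_mor_eq; exact: concept_KlatK. Qed.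

End Contexts.

(** * Conjugation by isomorphisms and the restriction to contexts *)

Lemma functor_transport (C D : category) (Fo Go : C -> D) (F : functor Fo)
    (i : forall X, mor (Go X) (Fo X)) (j : forall X, mor (Fo X) (Go X)) :
  (forall X, cmp (j X) (i X) = idc (Go X)) ->
  (forall X, cmp (i X) (j X) = idc (Fo X)) ->
  exists G : functor Go, forall (X Y : C) (f : mor X Y),
    cmp (i Y) (G X Y f) = cmp (F X Y f) (i X).
Proof.
move=> ji ij.
pose G X Y (f : mor X Y) := cmp (j Y) (cmp (F X Y f) (i X)).
have G1 X : G X X (idc X) = idc (Go X) by rewrite /G fmor_id cmp1l ji.
have iG X Y (f : mor X Y) : cmp (i Y) (G X Y f) = cmp (F X Y f) (i X).
  by rewrite /G cmpA ij cmp1l.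
have GM X Y Z (g : mor Y Z) (f : mor X Y) :
    G X Z (cmp g f) = cmp (G Y Z g) (G X Y f).
  (* The factor [G X Y f] stays folded so that [iG] can absorb the [i Y] before it. *)
  by rewrite {1 2}/G fmor_cmp -!cmpA iG.
by exists (Functor G1 GM).
Qed.

(** [HK] and [HL] are bound first because the object maps of the two functors are built from
    them. *)
Theorem proposition7p4p4 (d : Order.disp_t) (Q : divQuantaleType d) :
  exists (HK : forall phi : Info Q,
            skeletal (Klat phi) /\ complete (Klat phi))
         (HL : forall c : Ctx Q,
            skeletal (ConceptLattice c) /\ complete (ConceptLattice c)),
  let Kinfo_ob : opcat (Info Q) -> CCat Q := fun phi => CCatOb (HK phi) in
  let Kctx_ob : opcat (Ctx Q) -> CCat Q := fun c => CCatOb (HL c) in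
  exists (Kinfo : functor Kinfo_ob) (Kctx : functor Kctx_ob),
    (forall (phi psi : Info Q) (f : @mor (Info Q) phi psi) (lam : Klat psi),
        sval (Kinfo psi phi f lam) =
          low phi (up phi (pushforward (info_snd f) (sval lam))))
    /\
    exists i : forall c : Ctx Q,
        @mor (CCat Q) (Kctx_ob c) (Kinfo_ob (info_of_ctx c)),
      (forall (c : Ctx Q) (p : ConceptLattice c), sval (i c p) = intent p)
      /\ (forall c : Ctx Q, is_iso (i c))
      /\ (forall (c c' : Ctx Q) (f : @mor (Ctx Q) c c'),
            cmp (i c) (Kctx c' c f) =
              cmp (Kinfo (info_of_ctx c') (info_of_ctx c) f) (i c')).
Proof.
exists (fun phi : info_ob Q => Klat_ccat phi), (@ConceptLattice_ccat _ Q) => /=.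
(* [Kctx'] is [Kinfo] precomposed with the full inclusion of contexts; conjugating it by the
   isomorphisms [intent_mor] replaces the fixed points by concepts. *)
pose Kctx' : @functor (opcat (Ctx Q)) (CCat Q)
    (fun c => Kinfo_ob (info_of_ctx c)) :=
  @Functor (opcat (Ctx Q)) (CCat Q) (fun c => Kinfo_ob (info_of_ctx c))
    (fun c c' f => Kinfo (info_of_ctx c) (info_of_ctx c') f)
    (fun c => fmor_id Kinfo (info_of_ctx c))
    (fun a b c g f => @fmor_cmp _ _ _ Kinfo
      (info_of_ctx a) (info_of_ctx b) (info_of_ctx c) g f).
have [Kctx KctxE] := @functor_transport (opcat (Ctx Q)) (CCat Q) _ (@Kctx_ob _ Q)
  Kctx' (@intent_mor _ Q) (@concept_mor _ Q) (@intent_morK _ Q)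
  (@concept_morK _ Q).
exists Kinfo, Kctx; split=> [//|].
exists (@intent_mor _ Q); split=> [//|]; split=> [c|c c' f].
  by exists (concept_mor c); split; [exact: intent_morK|exact: concept_morK].
exact: KctxE c' c f.
Qed.
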